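(* Separability is a hereditary property of graphs: if a finite graph $G$ is separable, then every subgraph of $G$ is separable.
   Context: A graph $G=(V,E)$ is separable if there exist non-negative real weights $w(e)$, $e\in E$, and a threshold $\alpha\in\mathbb{R}$ such that for every $E'\subseteq E$: $\sum_{e\in E'}w(e)\ge\alpha$ if and only if the spanning subgraph $(V,E')$ is connected.
   Formalization: The graph G is additionally assumed connected: a disconnected graph is vacuously separable, so K4 minus an edge plus an isolated vertex is separable, while its subgraph K4 minus an edge is not; the subgraph itself stays arbitrary. *)

(* Defs.v *)
From mathcomp Require Import all_boot all_order all_algebra.
From mathcomp Require Import reals.

Set Implicit Arguments.
Unset Strict Implicit.
Unset Printing Implicit Defensive.

Import Order.TTheory GRing.Theory Num.Theory.
Local Open Scope ring_scope.

(* The vertex set is a subset of an ambient finite type T, so that a graph    *)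
(* and its subgraphs live in the same type.                                   *)
Record graph (T : finType) := Graph {
  vertices : {set T};
  edges : {set {set T}};
  edgesP : forall e : {set T}, e \in edges -> e \subset vertices /\ #|e| = 2%N
}.

Section Graphs.
Variable T : finType.
Implicit Types (G H : graph T) (V : {set T}) (F : {set {set T}}).

Definition subgraph H G : Prop :=
  vertices H \subset vertices G /\ edges H \subset edges G.

Definition adjacent F : rel T := fun x y => [set x; y] \in F.

(* Connectedness of the graph (V, F). The empty graph counts as connected;    *)
(* it is separable under either convention.                                   *)
Definition connected V F : Prop :=
  forall x y, x \in V -> y \in V -> connect (adjacent F) x y.

Definition connected_graph G : Prop := connected (vertices G) (edges G).

(* The values of w outside edges G are irrelevant.                            *)
Definition separable (R : realType) G : Prop :=
  exists (w : {set T} -> R) (alpha : R),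
    (forall e, e \in edges G -> 0 <= w e) /\
    (forall F, F \subset edges G ->
       (\sum_(e in F) w e >= alpha <-> connected (vertices G) F)).

End Graphs.

(* Main.v *)
Require Import Defs.
From mathcomp Require Import all_boot all_order all_algebra.
From mathcomp Require Import reals.

(** Deleting an edge keeps the weights and the threshold.  For the vertices,
    reverse the growth of [H] inside the connected graph [G]: as long as the
    current vertex set [W] is nonempty and is not all of [vertices G], some edge
    of [G] joins a vertex [x] of [W] to a vertex [y] outside [W].  Attaching [y]
    as a pendant vertex does not change which edge sets are connected, so
    separability descends from the larger graph to the smaller one by lowering
    the threshold by [w [set x; y]]. *)

Set Implicit Arguments.
Unset Strict Implicit.
Unset Printing Implicit Defensive.

Import Order.TTheory GRing.Theory Num.Theory.
Local Open Scope ring_scope.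

Section Heredity.
Variables (R : realType) (T : finType).
Implicit Types (V W : {set T}) (D F : {set {set T}}) (G : graph T).

(** Separability with vertices and edges as independent sets, so that the induction can enlarge both
    without rebuilding a [graph]. *)
Definition separable_pair V D : Prop :=
  exists (w : {set T} -> R) (alpha : R),
    (forall e, e \in D -> 0 <= w e) /\
    (forall F, F \subset D -> (\sum_(e in F) w e >= alpha <-> connected V F)).

Lemma separable_pair_subset V D D' :
  D' \subset D -> separable_pair V D -> separable_pair V D'.
Proof.
move=> sD [w [alpha [w_ge0 wP]]]; exists w, alpha; split=> [e eD'|F sF].
  exact/w_ge0/(subsetP sD).
exact/wP/(subset_trans sF).
Qed.

Lemma separable_pair0 D : separable_pair set0 D.
Proof.
exists (fun=> 0), 0; split=> // F _; rewrite big1 //.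
by split=> // _ x y; rewrite inE.
Qed.

Lemma adjacent_sym F : symmetric (adjacent F).
Proof. by move=> x y; rewrite /adjacent setUC. Qed.

Lemma connect_adjacent_sym F : connect_sym (adjacent F).
Proof. exact/sym_connect_sym/adjacent_sym. Qed.

Lemma connected_pendant W F x y : x \in W -> y \notin W ->
    (forall e, e \in F -> e \subset W) ->
  connected (y |: W) ([set x; y] |: F) <-> connected W F.
Proof.
move=> xW yW FW.
have nxy : x != y by apply: contraNneq yW => <-.
(* The retraction of [y |: W] onto [W]: it collapses the pendant edge to [x] and fixes the edges of
   [F], so it turns walks into walks in [F]. *)
pose r z := if z == y then x else z.
have rW z : z \in W -> r z = z.
  by rewrite /r => zW; case: eqP => // zy; rewrite -zy zW in yW.
have rVW z : z \in y |: W -> r z \in W.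
  by rewrite /r !inE; case: eqP.
split=> cF a b.
  move=> aW bW; rewrite -(rW a aW) -(rW b bW).
  have /connectP[p] := cF a b (setU1r y aW) (setU1r y bW).
  move=> + ->; elim: p {aW} a => [|c p IHp] a //= /andP[ac /IHp].
  apply: connect_trans; move: ac; rewrite /adjacent in_setU1 => /orP[/eqP E|acF].
    have : a \in [set x; y] by rewrite -E set21.
    have : c \in [set x; y] by rewrite -E set22.
    by rewrite /r !inE => /orP[]/eqP-> /orP[]/eqP->;
       rewrite ?eqxx ?(negPf nxy) connect0.
  by rewrite !rW ?connect1 //; apply: (subsetP (FW _ acF)); rewrite ?set21 ?set22.
(* Conversely, a walk from [r a] to [r b] extends to [a] and [b] along the pendant edge. *)
have conr z : connect (adjacent ([set x; y] |: F)) (r z) z.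
  rewrite /r; case: eqP => [->|_]; last exact: connect0.
  by apply: connect1; rewrite /adjacent setU11.
move=> aV bV; apply: connect_trans (conr b).
rewrite connect_adjacent_sym; apply: connect_trans (conr a).
rewrite connect_adjacent_sym; apply: connect_sub (cF _ _ (rVW a aV) (rVW b bV)).
by move=> c d cd; apply: connect1; rewrite /adjacent setU1r.
Qed.

Lemma separable_pair_pendant W D x y : x \in W -> y \notin W ->
    (forall e, e \in D -> e \subset W) ->
  separable_pair (y |: W) ([set x; y] |: D) -> separable_pair W D.
Proof.
move=> xW yW DW [w [alpha [w_ge0 wP]]].
exists w, (alpha - w [set x; y]); split=> [e eD|F sF].
  exact/w_ge0/setU1r.
have FW e : e \in F -> e \subset W by move/(subsetP sF)/DW.
(* Hence adding the pendant edge to [F] raises its weight by exactly [w [set x; y]]. *)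
have xyF : [set x; y] \notin F.
  by apply: contra yW => /FW/subsetP; apply; rewrite set22.
rewrite -(connected_pendant xW yW FW) -wP ?setUS //.
by rewrite (big_setU1 _ xyF) /= lerBlDl.
Qed.

(** Otherwise [W] would be closed under adjacency, and a path from a vertex of [W] could not reach
    the rest of [G]. *)
Lemma crossing_edge G W : connected_graph G -> W != set0 ->
    W \proper vertices G ->
  exists x y, [/\ x \in W, y \notin W & [set x; y] \in edges G].
Proof.
move=> cG /set0Pn[a aW] /properP[sWG [b bG bW]].
have [/existsP[x /existsP[y /and3P[xW yW xy]]]|noedge] :=
  boolP [exists x, exists y, [&& x \in W, y \notin W & [set x; y] \in edges G]].
  by exists x, y.
have clW : closed (adjacent (edges G)) W.
  apply: (intro_closed (@connect_adjacent_sym _)) => x y xy xW.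
  apply: contraNT noedge => yW.
  by apply/existsP; exists x; apply/existsP; exists y; apply/and3P.
have := closed_connect clW (cG a b (subsetP sWG a aW) bG).
by rewrite aW (negPf bW).
Qed.

Lemma separable_pair_connected G W D : connected_graph G -> separable R G ->
    W != set0 -> W \subset vertices G -> D \subset edges G ->
    (forall e, e \in D -> e \subset W) ->
  separable_pair W D.
Proof.
(* Induction on the number of vertices of [G] missing from [W]; [D] varies too, since it gains the
   crossing edge. *)
move=> cG sG; have [n] := ubnP #|vertices G :\: W|.
elim: n W D => // n IHn W D leWn W0 sWG sDG DW.
have [WG|neqWG] := eqVneq W (vertices G).
  by rewrite WG; apply: separable_pair_subset sDG sG.
have [x [y [xW yW xyG]]] : exists x y,
    [/\ x \in W, y \notin W & [set x; y] \in edges G].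
  by apply: crossing_edge; rewrite // properEneq neqWG.
have yG : y \in vertices G.
  by have [/subsetP sxy _] := edgesP xyG; apply: sxy; rewrite set22.
apply: (separable_pair_pendant xW yW DW); apply: IHn.
- rewrite -ltnS; apply: leq_trans leWn; rewrite ltnS; apply/proper_card/properP; split.
    by rewrite setDS ?subsetUr.
  by exists y; rewrite !inE ?yW ?eqxx.
- by apply/set0Pn; exists y; rewrite setU11.
- by rewrite subUset sub1set yG.
- by rewrite subUset sub1set xyG.
- move=> e /setU1P[->|/DW eW]; last exact: subset_trans eW (subsetUr _ _).
  by rewrite subUset !sub1set setU11 setU1r.
Qed.

End Heredity.

(* A disconnected graph is vacuously separable (alpha larger than the total   *)
(* weight), so heredity is a statement about connected G; H is arbitrary.     *)
Theorem theorem4 (R : realType) (T : finType) (G H : graph T) :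
  connected_graph G -> separable R G -> subgraph H G -> separable R H.
Proof.
move=> cG sG [sV sE].
(* No edge leaves the empty set, so this case is settled directly, with zero weights and
   threshold. *)
have [V0|V0] := eqVneq (vertices H) set0.
  by rewrite /separable V0; apply: separable_pair0.
by apply: (separable_pair_connected cG sG) => // e /edgesP[].
Qed.
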